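(* There is a constant $c$ independent of $n$ such that for all integers $n\ge2$ the operator norms of $\mathcal L_n$ and $\mathcal L_n^*$, as operators $C(\triangle_H)\to C(\triangle_H)$ with the uniform norm, satisfy $$\|\mathcal L_n\|\le c(\log n)^3\qquad\text{and}\qquad\|\mathcal L_n^*\|\le c(\log n)^3.$$
   Context: Let $\mathbb R^4_H=\{\mathbf t\in\mathbb R^4: t_1+t_2+t_3+t_4=0\}$, $\mathbb Z^4_H=\mathbb Z^4\cap\mathbb R^4_H$, $\mathbb H=\{\mathbf k\in\mathbb Z^4_H: k_1\equiv k_2\equiv k_3\equiv k_4\pmod4\}$, $\phi_{\mathbf k}(\mathbf t)=e^{\frac{\pi i}{2}\mathbf k\cdot\mathbf t}$. Let $\mathcal G=S_4$ act on $\mathbf t$ by permuting coordinates, $\mathbf t\mapsto\mathbf t\sigma$, with sign $\operatorname{sgn}\sigma$; $\mathsf{TC}_{\mathbf k}(\mathbf t)=\frac1{24}\sum_\sigma\phi_{\mathbf k}(\mathbf t\sigma)$, $\mathsf{TS}_{\mathbf k}(\mathbf t)=-\frac1{24}\sum_\sigma\operatorname{sgn}(\sigma)\phi_{\mathbf k}(\mathbf t\sigma)$. Let $\triangle_H=\{\mathbf t\in\mathbb R^4_H: t_1-t_2,\,t_2-t_3,\,t_3-t_4,\,t_1-t_4\in[0,1]\}$, $\Lambda_n=\{\mathbf k\in\mathbb H: k_4\le k_3\le k_2\le k_1\le k_4+4n\}$, $\Lambda_n^\circ=\{\mathbf k\in\mathbb H: k_4<k_3<k_2<k_1<k_4+4n\}$.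 For $\mathbf j\in\Lambda_n$ with relations (a) $j_1=j_2$, (b) $j_2=j_3$, (c) $j_3=j_4$, (d) $j_1=j_4+4n$: $\lambda^{(n)}_{\mathbf j}=24$ if none holds, $12$ if exactly one, $6$ if exactly $\{(a),(c)\}$ or $\{(b),(d)\}$ hold, $4$ if exactly two other ones hold, $1$ if three hold. For $f\in C(\triangle_H)$: $\mathcal L_nf(\mathbf t)=\sum_{\mathbf j\in\Lambda_n^\circ}f(\tfrac{\mathbf j}{4n})\frac{144}{n^3}\sum_{\mathbf k\in\Lambda_n^\circ}\mathsf{TS}_{\mathbf k}(\mathbf t)\overline{\mathsf{TS}_{\mathbf k}(\tfrac{\mathbf j}{4n})}$ and $\mathcal L_n^*f(\mathbf t)=\sum_{\mathbf j\in\Lambda_n}f(\tfrac{\mathbf j}{4n})\frac{\lambda^{(n)}_{\mathbf j}}{4n^3}\sum_{\mathbf k\in\Lambda_n}\lambda^{(n)}_{\mathbf k}\mathsf{TC}_{\mathbf k}(\mathbf t)\overline{\mathsf{TC}_{\mathbf k}(\tfrac{\mathbf j}{4n})}$. *)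

(* Defs.v *)
From HB Require Import structures.
From mathcomp Require Import all_boot all_order all_algebra all_fingroup.
From mathcomp Require Import all_classical all_reals all_analysis.
From mathcomp Require Import complex.
Set Implicit Arguments. Unset Strict Implicit. Unset Printing Implicit Defensive.
Import Order.TTheory GRing.Theory Num.Theory.
Import numFieldNormedType.Exports.
Local Open Scope classical_set_scope.
Local Open Scope ring_scope.

(* Coordinates t_1,...,t_4 of the paper are the entries t ord0 0..3 of a row
   vector; integer vectors k are functions 'I_4 -> int (k_1 = k 0, ..., k_4 = k 3). *)

Section Defs.
Variable R : realType.

Definition i1 : 'I_4 := @Ordinal 4 0 isT.
Definition i2 : 'I_4 := @Ordinal 4 1 isT.
Definition i3 : 'I_4 := @Ordinal 4 2 isT.
Definition i4 : 'I_4 := @Ordinal 4 3 isT.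

Definition inH (k : 'I_4 -> int) : bool :=
  (\sum_(i < 4) k i == 0) && [forall i, forall j, (k i == k j %[mod 4])%Z].

Definition inLambda (n : nat) (k : 'I_4 -> int) : bool :=
  [&& inH k, k i4 <= k i3, k i3 <= k i2, k i2 <= k i1 & k i1 <= k i4 + (4 * n)%:Z].

Definition inLambdao (n : nat) (k : 'I_4 -> int) : bool :=
  [&& inH k, k i4 < k i3, k i3 < k i2, k i2 < k i1 & k i1 < k i4 + (4 * n)%:Z].

(* Points of the box [-4n, 4n]^4, which contains Lambda_n (and Lambda_n^circ):
   if k in Lambda_n then k_4 <= k_i <= k_4 + 4n and sum k_i = 0, hence |k_i| <= 4n. *)
Definition boxpt (n : nat) (a : {ffun 'I_4 -> 'I_(8 * n + 1)}) : 'I_4 -> int :=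
  fun i => (a i)%:Z - (4 * n)%:Z.

Definition sumLambda (n : nat) (F : ('I_4 -> int) -> R[i]) : R[i] :=
  \sum_(a : {ffun 'I_4 -> 'I_(8 * n + 1)} | inLambda n (boxpt a)) F (boxpt a).
Definition sumLambdao (n : nat) (F : ('I_4 -> int) -> R[i]) : R[i] :=
  \sum_(a : {ffun 'I_4 -> 'I_(8 * n + 1)} | inLambdao n (boxpt a)) F (boxpt a).

Definition dotk (k : 'I_4 -> int) (t : 'rV[R]_4) : R :=
  \sum_(i < 4) (k i)%:~R * t ord0 i.

Definition phi (k : 'I_4 -> int) (t : 'rV[R]_4) : R[i] :=
  (cos (pi / 2 * dotk k t) +i* sin (pi / 2 * dotk k t))%C.

Definition tperm (t : 'rV[R]_4) (s : {perm 'I_4}) : 'rV[R]_4 :=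
  \row_(i < 4) t ord0 (s i).

Definition TC (k : 'I_4 -> int) (t : 'rV[R]_4) : R[i] :=
  (24^-1)%:C%C * \sum_(s : {perm 'I_4}) phi k (tperm t s).

Definition TS (k : 'I_4 -> int) (t : 'rV[R]_4) : R[i] :=
  - ((24^-1)%:C%C * \sum_(s : {perm 'I_4}) (-1) ^+ (odd_perm s) * phi k (tperm t s)).

Definition triangleH : set 'rV[R]_4 :=
  [set t | \sum_(i < 4) t ord0 i = 0 /\
     0 <= t ord0 i1 - t ord0 i2 <= 1 /\ 0 <= t ord0 i2 - t ord0 i3 <= 1 /\
     0 <= t ord0 i3 - t ord0 i4 <= 1 /\ 0 <= t ord0 i1 - t ord0 i4 <= 1].

Definition lambdan (n : nat) (j : 'I_4 -> int) : R :=
  let a := j i1 == j i2 in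
  let b := j i2 == j i3 in
  let c := j i3 == j i4 in
  let d := j i1 == j i4 + (4 * n)%:Z in
  let m := (a + b + c + d)%N in
  if m == 0%N then 24
  else if m == 1%N then 12
  else if m == 2%N then (if (a && c) || (b && d) then 6 else 4)
  else 1.

Definition node (n : nat) (j : 'I_4 -> int) : 'rV[R]_4 :=
  \row_(i < 4) ((j i)%:~R / (4 * n)%:R).

Definition Ln (n : nat) (f : 'rV[R]_4 -> R[i]) (t : 'rV[R]_4) : R[i] :=
  sumLambdao n (fun j => f (node n j) * (144 / (n%:R ^+ 3))%:C%C *
     sumLambdao n (fun k => TS k t * conjc (TS k (node n j)))).

Definition Lnstar (n : nat) (f : 'rV[R]_4 -> R[i]) (t : 'rV[R]_4) : R[i] :=
  sumLambda n (fun j => f (node n j) * (lambdan n j / (4 * n%:R ^+ 3))%:C%C *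
     sumLambda n (fun k => (lambdan n k)%:C%C * TC k t * conjc (TC k (node n j)))).

End Defs.

(* Main.v *)
Require Import Defs.
From HB Require Import structures.
From mathcomp Require Import all_boot all_order all_algebra all_fingroup.
From mathcomp Require Import all_classical all_reals all_analysis.
From mathcomp Require Import complex.
From mathcomp Require Import zify ring lra.
Import Order.TTheory GRing.Theory Num.Theory.
Import numFieldNormedType.Exports.
Local Open Scope classical_set_scope.
Local Open Scope ring_scope.
Set Implicit Arguments. Unset Strict Implicit. Unset Printing Implicit Defensive.

(* The scaled gaps d = ((k1-k2)/4, (k2-k3)/4, (k3-k4)/4, n-(k1-k4)/4) identify
   Lambda_n with the lattice simplex {d in N^4 : sum d = n}, and turn phi_k(w)
   into e(sum_i d_i P_i), with e(x) = exp(2 pi i x) and P_i the prefix sums of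
   w.  Expanding TC and TS over permutations, both Lebesgue functions are
   bounded by sums over the nodes j of |K(P)|, where K is a simplex sum whose
   weight depends only on which gaps vanish.

   A simplex has four facets, so treating every facet by a one-dimensional
   Dirichlet kernel would cost (log n)^4.  Instead split K by the barycentric
   identity n = sum_l d_l.  In the l-th piece the weight d_l agrees on the
   simplex with a tent function, whose Fejer kernel has bounded L^1 norm, and
   only the three other facets remain.  The constraint sum d = n is removed by a
   discrete Fourier transform modulo 8n, which makes each piece an average of
   products of three Dirichlet kernels.

   The arguments of these kernels move with j through the differences of prefix
   sums of a permutation of j; these are integers of size O(n) that determine j.
   Hence the sum over j is at most a product of three one-dimensional grid sums,
   each O(n log n). *)

Local Notation normc := ComplexField.Normc.normc.

(** * Complex exponentials and a lower bound for |1 - e(v)| *)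

Section ComplexExponential.
Variable R : realType.
Implicit Types (x y v : R) (z w : R[i]).

Lemma normc_real x : normc x%:C%C = `|x|.
Proof. by rewrite /= expr0n /= addr0 sqrtr_sqr. Qed.

Lemma normc_ge0 z : 0 <= normc z.
Proof. by case: z => a b; rewrite /= sqrtr_ge0. Qed.

Lemma normc_conjc z : normc (conjc z) = normc z.
Proof. by case: z => a b; rewrite /= sqrrN. Qed.

Lemma normc_sum (I : finType) (P : pred I) (F : I -> R[i]) :
  normc (\sum_(i | P i) F i) <= \sum_(i | P i) normc (F i).
Proof.
elim/big_rec2: _ => [|i x z _ h]; first by rewrite ComplexField.Normc.normc0.
exact: le_trans (le_normcD _ _) (lerD (lexx _) h).
Qed.

Lemma normc_prod (I : finType) (P : pred I) (F : I -> R[i]) :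
  normc (\prod_(i | P i) F i) = \prod_(i | P i) normc (F i).
Proof.
elim/big_rec2: _ => [|i x z _ <-]; first by rewrite ComplexField.Normc.normc1.
by rewrite ComplexField.Normc.normcM.
Qed.

Lemma normc_nat n : normc (n%:R : R[i]) = n%:R.
Proof.
have -> : n%:R = (n%:R : R)%:C%C by rewrite rmorph_nat.
by rewrite normc_real normr_nat.
Qed.

Definition cexp x : R[i] := (cos (2 * pi * x) +i* sin (2 * pi * x))%C.

Lemma cexp0 : cexp 0 = 1.
Proof. by rewrite /cexp mulr0 cos0 sin0. Qed.

Lemma cexpD x y : cexp (x + y) = cexp x * cexp y.
Proof.
rewrite /cexp mulrDr cosD sinD; congr (_ +i* _)%C.
by rewrite addrC.
Qed.

Lemma conjc_cexp x : conjc (cexp x) = cexp (- x).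
Proof. by rewrite /cexp mulrN cosN sinN. Qed.

Lemma normc_cexp x : normc (cexp x) = 1.
Proof. by rewrite /= cos2Dsin2 sqrtr1. Qed.

Lemma cexp_nat n : cexp n%:R = 1.
Proof.
elim: n => [|n IHn]; first exact: cexp0.
rewrite -natr1 cexpD IHn mul1r /cexp mulr1 mulr_natl.
by rewrite cos2pi sin2pi.
Qed.

Lemma cexp_int (m : int) : cexp m%:~R = 1.
Proof.
case: m => n; first exact: cexp_nat.
by rewrite NegzE mulrNz -conjc_cexp cexp_nat /= oppr0.
Qed.

Lemma cexpMn n x : cexp (n%:R * x) = cexp x ^+ n.
Proof.
elim: n => [|n IHn]; first by rewrite mul0r cexp0.
by rewrite -natr1 mulrDl mul1r cexpD IHn exprSr.
Qed.

Lemma cexp_sum (I : finType) (P : pred I) (F : I -> R) :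
  cexp (\sum_(i | P i) F i) = \prod_(i | P i) cexp (F i).
Proof. exact: (big_morph _ cexpD cexp0). Qed.

(** Since cos(2x) = 2 cos(x)^2 - 1 is nonnegative here, cos(x)^2 is at least 1/2, which exceeds
    1/4. *)
Lemma cos_ge_half x : 0 <= x <= pi / 4 -> 1 / 2 <= cos x.
Proof.
move=> /andP[x0 xp]; have pi0 := pi_gt0 R.
have c0 : 0 <= cos x by apply: cos_ge0_pihalf; apply/andP; split; lra.
have : 0 <= cos (x *+ 2).
  by apply: cos_ge0_pihalf; rewrite (mulr2n x); apply/andP; split; lra.
rewrite cos_mulr2n => h; rewrite leNgt; apply/negP => hc.
nra.
Qed.

(** With x = 2y, the mean value theorem and cos >= 1/2 on [0, pi/4] give sin y >= y/2; then sin x =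
    2 sin y cos y >= y/2. *)
Lemma sin_ge_quarter x : 0 <= x <= pi / 2 -> x / 4 <= sin x.
Proof.
move=> /andP[x0 xp]; have pi0 := pi_gt0 R.
pose y := x / 2; have -> : x = y *+ 2 by rewrite /y (mulr2n (x / 2)); lra.
have y0 : 0 <= y by rewrite /y; lra.
have yp : y <= pi / 4 by rewrite /y; lra.
have cy : 1 / 2 <= cos y by apply: cos_ge_half; rewrite y0.
suff sy : y / 2 <= sin y.
  have h : 1 / 2 * (y / 2) <= cos y * sin y by apply: ler_pM; lra.
  by rewrite sin_mulr2n (mulr2n (cos y * sin y)); lra.
move: y0; rewrite le_eqVlt => /predU1P[<-|y0]; first by rewrite mul0r sin0.
have [c /[!in_itv]/= /andP[c0 cy']] := MVT y0 (fun x _ => is_derive_sin x)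
  (continuous_subspaceT (@continuous_sin R)).
rewrite sin0 !subr0 => ->.
have : 1 / 2 <= cos c by apply: cos_ge_half; apply/andP; split; lra.
nra.
Qed.

(** The modulus equals 2 sin(pi v). The linear bound for the sine applies directly for v <= 1/2 and
    after the reflection v -> 1 - v otherwise; pi >= 2 absorbs the constant. *)
Lemma normc_1subcexp v : 0 <= v <= 1 -> Num.min v (1 - v) <= normc (1 - cexp v).
Proof.
move=> /andP[v0 v1]; have pi0 := pi_gt0 R.
have pi2 := pi_ge2 R.
have s0 : 0 <= sin (pi * v) by apply: sin_ge0_pi; apply/andP; split; nra.
have -> : normc (1 - cexp v) = 2 * sin (pi * v).
  rewrite -[RHS]ger0_norm ?mulr_ge0// -sqrtr_sqr /=; congr Num.sqrt.
  have -> : 2 * pi * v = (pi * v) *+ 2 by rewrite (mulr2n (pi * v)); lra.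
  have h := cos2Dsin2 (pi * v).
  rewrite cos_mulr2n sin_mulr2n.
  have -> : cos (pi * v) ^+ 2 = 1 - sin (pi * v) ^+ 2 by lra.
  have -> : (0 - (cos (pi * v) * sin (pi * v) + cos (pi * v) * sin (pi * v))) ^+ 2 
     = 4 * cos (pi * v) ^+ 2 * sin (pi * v) ^+ 2 by ring.
  have -> : cos (pi * v) ^+ 2 = 1 - sin (pi * v) ^+ 2 by lra.
  ring.
rewrite ge_min; case: (leP v (1 / 2)) => hv.
  have h : pi * v / 4 <= sin (pi * v).
    by apply: sin_ge_quarter; apply/andP; split; nra.
  by apply/orP; left; nra.
have : pi * (1 - v) / 4 <= sin (pi * (1 - v)).
  by apply: sin_ge_quarter; apply/andP; split; nra.
have -> : pi * (1 - v) = - (pi * v) + pi by lra.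
by rewrite sinDpi sinN opprK => h; apply/orP; right; nra.
Qed.

End ComplexExponential.

(** * Dirichlet kernels and their sums over equispaced grids *)

Section DirichletKernel.
Variable R : realType.
Implicit Types (v a eps : R).

Definition dirichlet (N : nat) v : R[i] := \sum_(m < N) cexp (m%:R * v).

Lemma normc_dirichlet_le N v : normc (dirichlet N v) <= N%:R.
Proof.
apply: le_trans (normc_sum _ _) _.
under eq_bigr do rewrite normc_cexp.
by rewrite sumr_const card_ord.
Qed.

(** The geometric sum telescopes. The product form avoids dividing by 1 - e(v), which vanishes at
    integers. *)
Lemma normc_dirichletM_le N v :
  normc (dirichlet N v) * normc (1 - cexp v) <= 2.
Proof.
rewrite mulrC -ComplexField.Normc.normcM.
have -> : (1 - cexp v) * dirichlet N v = 1 - cexp (N%:R * v).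
  rewrite /dirichlet; under eq_bigr do rewrite cexpMn.
  by rewrite cexpMn -[1 - cexp v]opprB mulNr -subrX1 opprB.
apply: le_trans (le_normcD _ _) _.
by rewrite normcN normc_cexp ComplexField.Normc.normc1.
Qed.

Lemma dirichletD_int N v (m : int) : dirichlet N (v + m%:~R) = dirichlet N v.
Proof.
apply: eq_bigr => i _; rewrite mulrDr cexpD.
by rewrite -[i%:R * m%:~R]/((i%:Z)%:~R * m%:~R) -intrM cexp_int mulr1.
Qed.

(** The term q = 0 is zero because 0^-1 = 0. The induction step is 1/(m+1) <= ln(m+1) - ln m, which
    is ln(1+x) <= x at x = -1/(m+1). *)
Lemma harmonic_sum_le (L : nat) : (0 < L)%N ->
  \sum_(q < L) (q%:R : R)^-1 <= 1 + ln L%:R.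
Proof.
case: L => // L _.
apply: (@le_trans _ _ (\sum_(q < L.+2) (q%:R : R)^-1)).
  by rewrite [leRHS]big_ord_recr /= lerDl invr_ge0 ler0n.
elim: L => [|L IHL].
  by rewrite !big_ord_recr big_ord0 /= ln1 invr0 invr1 !addr0 ?add0r.
rewrite big_ord_recr /=.
have L1 : (0 : R) < L.+1%:R by rewrite ltr0n.
have L2 : (0 : R) < L.+2%:R by rewrite ltr0n.
suff h : (L.+2%:R : R)^-1 <= ln L.+2%:R - ln L.+1%:R.
  by apply: le_trans (lerD IHL h) _; rewrite le_eqVlt; apply/orP; left; apply/eqP; ring.
rewrite -lerN2 opprB -ln_div ?posrE//.
have -> : L.+1%:R / L.+2%:R = 1 + (- (L.+2%:R)^-1) :> R.
  rewrite -[X in _ = X + _](divff (lt0r_neq0 L2)) -[X in _ = _ + X]mulN1r -mulrDl.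
  by congr (_ / _); rewrite -[X in _ = X - 1]natr1 addrK.
apply: le_ln1Dx; rewrite ltrN2 invf_lt1// ltr1n.
by [].
Qed.

(** The point lies at distance at least q/L from 0 and (L-q-1)/L from 1, whence the two inverses. In
    the two end cells one of these distances degenerates; there the trivial bound N <= L is used,
    carried by the two indicators. *)
Lemma normc_dirichlet_grid_le (N L q : nat) eps :
  (N <= L)%N -> (q < L)%N -> 0 <= eps <= 1 ->
  normc (dirichlet N ((q%:R + eps) / L%:R)) <=
  L%:R * (q == 0%N)%:R + L%:R * (q == L.-1)%:R
  + 2 * L%:R * (q%:R^-1 + (L - q.+1)%:R^-1).
Proof.
move=> NL qL /andP[e0 e1]; set v := (_ / _).
have L0 : (0 : R) < L%:R by rewrite ltr0n; lia.
have D1 : normc (dirichlet N v) <= L%:R.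
  by apply: le_trans (normc_dirichlet_le _ _) _; rewrite ler_nat.
have h0 : 0 <= 2 * L%:R * (q%:R^-1 + (L - q.+1)%:R^-1) :> R.
  by rewrite !mulr_ge0 ?addr_ge0 ?invr_ge0 ?ler0n.
have [q0|q0] := eqVneq q 0%N.
  have h1 : 0 <= L%:R * (q == L.-1)%:R :> R by rewrite mulr_ge0 ?ler0n.
  by rewrite mulr1; lra.
have [q1|q1] := eqVneq q L.-1.
  by rewrite mulr1 mulr0 add0r; apply: (le_trans D1); rewrite lerDl.
rewrite !mulr0 !add0r.
have := @normc_dirichletM_le N v.
set D := normc _ in D1 *.
have qp : (0 : R) < q%:R by rewrite ltr0n; lia.
have q'p : (0 : R) < (L - q.+1)%:R by rewrite ltr0n; lia.
have Lq : L%:R = q%:R + 1 + (L - q.+1)%:R :> R.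
  by rewrite natr1 -natrD; congr _%:R; lia.
have v01 : 0 <= v <= 1.
  rewrite /v divr_ge0 ?addr_ge0 ?ler0n//= ler_pdivrMr// mul1r Lq; lra.
have := normc_1subcexp v01; set E := normc _ => hE hDE.
have D0 : 0 <= D by apply: normc_ge0.
have E0 : 0 < E.
  apply: lt_le_trans hE; rewrite lt_min; apply/andP; split.
    by apply: divr_gt0 => //; lra.
  by rewrite subr_gt0 ltr_pdivrMr// mul1r Lq; lra.
have DE : D <= 2 / E by rewrite ler_pdivlMr.
apply: (le_trans DE); rewrite -mulrA ler_pM2l ?ltr0n// mulrDr.
move: hE; rewrite ge_min => /orP[] hE.
  apply: (@le_trans _ _ (L%:R / q%:R)); last first.
    by rewrite lerDl divr_ge0 ?ltW.
  rewrite -invf_div lef_pV2 ?posrE// ?divr_gt0//.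
  by apply: le_trans hE; rewrite /v ler_pM2r ?invr_gt0//; lra.
apply: (@le_trans _ _ (L%:R / (L - q.+1)%:R)); last first.
  by rewrite lerDr divr_ge0 ?ltW.
rewrite -invf_div lef_pV2 ?posrE// ?divr_gt0//.
apply: le_trans hE; rewrite /v ler_pdivrMr// mulrBl mul1r divfK ?lt0r_neq0//.
by rewrite [in leRHS]Lq; lra.
Qed.

Lemma sum_dirichlet_period_le (N L : nat) eps :
  (N <= L)%N -> (0 < L)%N -> 0 <= eps <= 1 ->
  \sum_(q < L) normc (dirichlet N ((q%:R + eps) / L%:R)) <=
  L%:R * (6 + 4 * ln L%:R).
Proof.
move=> NL L0 he.
apply: (@le_trans _ _ (\sum_(q < L) (L%:R * ((q : nat) == 0%N)%:R +
    L%:R * ((q : nat) == L.-1)%:R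
  + 2 * L%:R * (q%:R^-1 + (L - q.+1)%:R^-1)))).
  by apply: ler_sum => q _; apply: normc_dirichlet_grid_le.
rewrite !big_split /= -!mulr_sumr big_split /=.
have -> : \sum_(q < L) ((L - q.+1)%:R : R)^-1 = \sum_(q < L) (q%:R : R)^-1.
  rewrite (reindex_inj rev_ord_inj) /=; apply: eq_bigr => q _.
  by congr (_%:R^-1); have := ltn_ord q; lia.
have one (k : nat) : (k < L)%N -> \sum_(q < L) ((q : nat) == k)%:R = 1 :> R.
  move=> kL; rewrite (bigD1 (Ordinal kL)) //= eqxx big1 ?addr0// => i.
  by rewrite -val_eqE /= => /negbTE ->.
(* The end cells contribute 2L and the two harmonic sums 4L(1 + ln L), which add up to L(6 + 4 ln
   L). *)
rewrite !one ?prednK//.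
have := harmonic_sum_le L0; set S := \sum_(_ < _) _ => hS.
have L0' : (0 : R) <= L%:R by rewrite ler0n.
have := ler_wpM2l L0' hS; lra.
Qed.

Lemma sum_periodic (h : nat -> R) (L K : nat) :
  (forall q, h (q + L)%N = h q) ->
  \sum_(0 <= q < K * L) h q = K%:R * \sum_(0 <= q < L) h q.
Proof.
move=> hL; elim: K => [|K IHK]; first by rewrite mul0n big_geq// mul0r.
rewrite mulSn addnC (@big_cat_nat _ _ _ (K * L)) ?leq_addr//= IHK.
rewrite -natr1 mulrDl mul1r; congr (_ + _).
rewrite -{1}[(K * L)%N]add0n big_addn addKn.
apply: eq_bigr => q _; elim: (K) => [|k IHk]; first by rewrite addn0.
by rewrite mulSnr addnA hL.
Qed.

(** Writing aL = kL + r + eps with 0 <= r < L and 0 <= eps < 1, periodicity removes k, and the shift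
    by r is covered by one extra period: hence K+1 in the bound. *)
Lemma sum_dirichlet_grid_le (N L K : nat) a :
  (N <= L)%N -> (0 < L)%N ->
  \sum_(0 <= q < K * L) normc (dirichlet N (a + q%:R / L%:R)) <=
  K.+1%:R * (L%:R * (6 + 4 * ln L%:R)).
Proof.
move=> NL L0.
have L0' : (0 : R) < L%:R by rewrite ltr0n.
pose f := Num.floor (a * L%:R); pose eps := a * L%:R - f%:~R.
have he : 0 <= eps <= 1.
  have /andP[h1 h2] := floor_itv (a * L%:R).
  by move: h2; rewrite intrD /eps -/f in h1 * => h2; apply/andP; split; lra.
pose r := absz (modz f L); pose k := divz f L.
have rL : (r < L)%N by rewrite /r; have := ltz_pmod f (_ : 0 < L%:Z); lia.
have fE : f = k * L%:Z + r%:Z by rewrite /k /r; have := divz_eq f L%:Z; have := modz_ge0 f (_ : L%:Z != 0); lia.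
pose H (q : nat) := normc (dirichlet N ((q%:R + eps) / L%:R)).
have HE q : normc (dirichlet N (a + q%:R / L%:R)) = H (q + r)%N.
  rewrite /H -(dirichletD_int N (((q + r)%:R + eps) / L%:R) k); congr (normc (dirichlet _ _)).
  have -> : a = (f%:~R + eps) / L%:R by rewrite /eps addrC subrK mulfK// lt0r_neq0.
  rewrite fE intrD intrM natrD !pmulrn.
  rewrite pmulrn in L0'; move: (k%:~R) (r%:~R) (q%:~R) (L%:~R) L0' => x y z w w0.
  by field; apply: lt0r_neq0.
have Hper q : H (q + L)%N = H q.
  rewrite /H -(dirichletD_int N ((q%:R + eps) / L%:R) 1).
  congr (normc (dirichlet _ _)).
  by rewrite natrD addrAC mulrDl divff// lt0r_neq0.
under eq_bigr do rewrite HE.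
have -> : \sum_(0 <= q < K * L) H (q + r)%N = \sum_(r <= q < K * L + r) H q.
  by rewrite -{2}[r]add0n big_addn addnK.
apply: (@le_trans _ _ (\sum_(0 <= q < K.+1 * L) H q)).
  rewrite [leRHS](@big_cat_nat _ _ _ r) ?leq0n//=; last by nia.
  rewrite [X in _ <= _ + X](@big_cat_nat _ _ _ (K * L + r)) ?leq_addl//=; last by nia.
  rewrite addrCA lerDl addr_ge0// sumr_ge0// => q _; exact: normc_ge0.
rewrite sum_periodic// ler_pM2l ?ltr0n// big_mkord.
exact: sum_dirichlet_period_le.
Qed.

End DirichletKernel.

(** * One-dimensional kernels attached to the facets of the simplex *)

Section FacetKernel.
Variable R : realType.
Implicit Types (v a : R).

(** Here [z] records whether the gap vanishes: [true] gives the constant 1, [false] a modulated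
    Dirichlet kernel. The range 0..2n matches the one used for [tent]. *)
Definition facet_kernel (n : nat) (z : bool) v : R[i] :=
  \sum_(m < (2 * n).+1) (((m : nat) == 0%N) == z)%:R * cexp (m%:R * v).

Lemma facet_kernel_true n v : facet_kernel n true v = 1.
Proof.
rewrite /facet_kernel big_ord_recl /= mul0r cexp0 mulr1 big1 ?addr0//.
by move=> i _; rewrite mul0r.
Qed.

Lemma facet_kernel_false n v :
  facet_kernel n false v = cexp v * dirichlet (2 * n) v.
Proof.
rewrite /facet_kernel big_ord_recl /= mul0r add0r mulr_sumr.
apply: eq_bigr => i _; rewrite mul1r -cexpD; congr cexp.
by rewrite /bump /= natrD mulrDl mul1r.
Qed.

Lemma ln_ge_half (n : nat) : (2 <= n)%N -> (1 / 2 : R) <= ln n%:R.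
Proof.
move=> n2; apply: (@le_trans _ _ (ln 2)); last first.
  by rewrite ler_ln ?posrE ?ler_nat ?ltr0n//; lia.
rewrite -lerN2 -lnV ?posrE//.
have := @le_ln1Dx R (- (1 / 2)).
have -> : (1 + - (1 / 2) : R) = 2^-1 by lra.
by apply; lra.
Qed.

Lemma sum_facet_kernel_le n z a : (2 <= n)%N ->
  \sum_(q < (32 * n).+1) normc (facet_kernel n z (a + q%:R / (4 * n)%:R))
  <= 960 * (n%:R * ln n%:R).
Proof.
move=> n2; have l2 := ln_ge_half n2.
have n0 : (2 : R) <= n%:R by rewrite ler_nat.
case: z.
  under eq_bigr do rewrite facet_kernel_true ComplexField.Normc.normc1.
  rewrite sumr_const card_ord -[(32 * n).+1]addn1 natrD natrM.
  have := ler_wpM2l (ler0n R n) l2; lra.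
under eq_bigr => q _.
  rewrite facet_kernel_false ComplexField.Normc.normcM normc_cexp mul1r; over.
rewrite -(big_mkord xpredT (fun q : nat =>
  normc (dirichlet (2 * n) (a + q%:R / (4 * n)%:R)))).
(* The 32n+1 points fit into nine periods of length 4n, so the grid bound costs 10 * 4n * (6 + 4
   ln(4n)). *)
apply: (@le_trans _ _ (\sum_(0 <= q < 9 * (4 * n))
  normc (dirichlet (2 * n) (a + q%:R / (4 * n)%:R)))).
  rewrite [leRHS](@big_cat_nat _ _ _ (32 * n).+1) //=; last by lia.
  rewrite lerDl sumr_ge0// => q _; exact: normc_ge0.
apply: le_trans (sum_dirichlet_grid_le _ _ _ _) _; [lia|lia|].
(* For n >= 2 one has 4n <= n^3. Together with 6 <= 12 ln n this gives 40 n (12 + 12) ln n = 960 n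
   ln n. *)
have l4 : ln (4 * n)%:R <= 3 * ln n%:R :> R.
  have -> : 3 * ln n%:R = ln (n%:R ^+ 3) :> R.
    by rewrite lnXn ?mulr_natl//; lra.
  rewrite -natrX ler_ln ?posrE ?ltr0n ?ler_nat//; [nia|nia|].
  by rewrite expn_gt0; lia.
have h : n%:R * ln (4 * n)%:R <= n%:R * (3 * ln n%:R) :> R.
  by apply: ler_wpM2l.
have := ler_wpM2l (ler0n R n) l2.
rewrite !natrM; move: h; rewrite natrM; lra.
Qed.

End FacetKernel.

(** * Finite Fourier analysis: removing a linear constraint *)

Section FiniteFourier.
Variable R : realType.

Lemma cexp_neq1 (a b N : nat) : (a < b + N)%N -> (b < a + N)%N -> a != b ->
  cexp ((a%:R - b%:R) / N%:R : R) != 1.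
Proof.
move=> ab ba neq.
have N0 : (0 : R) < N%:R by rewrite ltr0n; lia.
have abR : (a%:R : R) < b%:R + N%:R by rewrite -natrD ltr_nat.
have baR : (b%:R : R) < a%:R + N%:R by rewrite -natrD ltr_nat.
have key (v : R) : 0 < v < 1 -> cexp v != 1.
  move=> /andP[v0 v1]; have := @normc_1subcexp _ v.
  rewrite (ltW v0) (ltW v1) => /(_ isT); apply: contraTN => /eqP ->.
  rewrite subrr ComplexField.Normc.normc0 -ltNge lt_min v0/=; lra.
move: neq; rewrite neq_ltn => /orP[] lt; last first.
  apply: key; rewrite divr_gt0 ?subr_gt0 ?ltr_nat//= ltr_pdivrMr// mul1r; lra.
have ltR : (a%:R : R) < b%:R by rewrite ltr_nat.
rewrite -[X in X != _]mulr1 -[X in _ * X](cexp_nat R 1) -cexpD; apply: key.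
have -> : (a%:R - b%:R) / N%:R + 1%:R = (a%:R + N%:R - b%:R) / N%:R :> R.
  by rewrite addrAC [in RHS]mulrDl divff ?lt0r_neq0.
apply/andP; split; first by apply: divr_gt0 => //; lra.
by rewrite ltr_pdivrMr// mul1r; lra.
Qed.

(** For a and b distinct this is a geometric sum whose ratio z satisfies z^N = 1 and, because |a -
    b| < N, z != 1. *)
Lemma sum_cexp_orthogonal (a b N : nat) : (a < b + N)%N -> (b < a + N)%N ->
  \sum_(q < N) cexp ((a%:R - b%:R) * (q%:R / N%:R)) = (N * (a == b))%:R :> R[i].
Proof.
move=> ab ba; have N0 : (0 : R) < N%:R by rewrite ltr0n; lia.
have [->|neq] := eqVneq a b.
  under eq_bigr do rewrite subrr mul0r cexp0.
  by rewrite sumr_const card_ord muln1.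
pose z := cexp ((a%:R - b%:R) / N%:R : R).
have z1 : z != 1 by exact: cexp_neq1.
have z10 : z - 1 != 0 by rewrite subr_eq0.
apply: (mulfI z10); rewrite muln0 mulr0.
have -> : \sum_(q < N) cexp ((a%:R - b%:R) * (q%:R / N%:R)) = \sum_(q < N) z ^+ q.
  by apply: eq_bigr => q _; rewrite -cexpMn; congr cexp; rewrite mulrCA.
rewrite -subrX1 -cexpMn mulrCA divff ?lt0r_neq0// mulr1.
by rewrite cexpD cexp_nat -conjc_cexp cexp_nat mul1r /= oppr0 subrr.
Qed.

(** Averaging characters modulo N detects sum d = n modulo N only; the two size hypotheses turn this
    congruence into an equality. The unconstrained sum then factors over the coordinates. *)
Lemma sum_ffun_prod_fourier (I : finType) (L N n : nat) (w : I -> nat -> R[i]) :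
  (n < N)%N -> (forall d : {ffun I -> 'I_L}, (\sum_i d i < n + N)%N) ->
  \sum_(d : {ffun I -> 'I_L} | (\sum_i (d i : nat))%N == n) \prod_i w i (d i) =
  N%:R^-1 * \sum_(q < N) cexp (- (n%:R * (q%:R / N%:R))) *
     \prod_i \sum_(m < L) w i m * cexp (m%:R * (q%:R / N%:R)).
Proof.
move=> nN dN; have N0 : (N%:R : R[i]) != 0 by rewrite pnatr_eq0; lia.
apply: (mulfI N0); rewrite mulrA divff// mul1r.
under [RHS]eq_bigr => q _ do rewrite bigA_distr_bigA mulr_sumr.
rewrite exchange_big big_mkcond mulr_sumr; apply: eq_bigr => d _ /=.
under [RHS]eq_bigr => q _.
  rewrite big_split /= mulrCA -cexp_sum -cexpD -mulr_suml -mulNr -mulrDl.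
  rewrite [- _ + _]addrC -natr_sum; over.
rewrite -mulr_sumr sum_cexp_orthogonal//; last by lia.
by case: eqP => _; rewrite ?muln1 ?muln0 ?mulr0// mulrC.
Qed.

Lemma normc_sum_ffun_prod_le (I : finType) (L N n : nat) (w : I -> nat -> R[i]) :
  (n < N)%N -> (forall d : {ffun I -> 'I_L}, (\sum_i d i < n + N)%N) ->
  normc (\sum_(d : {ffun I -> 'I_L} | (\sum_i (d i : nat))%N == n) \prod_i w i (d i))
  <= N%:R^-1 * \sum_(q < N)
     \prod_i normc (\sum_(m < L) w i m * cexp (m%:R * (q%:R / N%:R))).
Proof.
move=> nN dN; rewrite (sum_ffun_prod_fourier w nN dN) ComplexField.Normc.normcM.
rewrite ComplexField.Normc.normcV normc_nat ler_wpM2l ?invr_ge0 ?ler0n//.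
apply: le_trans (normc_sum _ _) _; apply: ler_sum => q _.
by rewrite ComplexField.Normc.normcM normc_cexp mul1r normc_prod.
Qed.

End FiniteFourier.

(** * The tent function and the Fejer kernel *)

Section Fejer.
Variable R : realType.

(* [max 0 (n - |m - n|)], written as the convolution square of an interval so
   that its kernel is a modulated square of a Dirichlet kernel. *)
Definition tent (n m : nat) : nat :=
  \sum_(r < n) \sum_(s < n) (m == (r + s).+1).

(** Each r < m is completed by exactly one s, namely m - r - 1, and no other r contributes. *)
Lemma tentE n m : (m <= n)%N -> tent n m = m.
Proof.
move=> mn; rewrite /tent.
transitivity (\sum_(r < n) ((r < m)%N : nat))%N.
  apply: eq_bigr => r _; case: ltnP => rm.
    have h : (m - r.+1 < n)%N by lia.
    rewrite (bigD1 (Ordinal h)) //= big1 ?addn0; first by case: eqP; lia.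
    by move=> s; rewrite -val_eqE /=; case: eqP; case: eqP; lia.
  by rewrite big1// => s _; case: eqP; lia.
rewrite -(big_mkord xpredT (fun r : nat => (r < m)%N : nat)) (@big_cat_nat _ _ _ m) //=.
rewrite (@eq_big_nat _ _ _ 0 m _ (fun=> 1%N)); last by move=> i /andP[_ ->].
rewrite (@eq_big_nat _ _ _ m n _ (fun=> 0%N)); last by move=> i /andP[h _]; rewrite ltnNge h.
by rewrite !sum_nat_const_nat muln0 addn0 subn0 muln1.
Qed.

Lemma tent_kernelE n (v : R) :
  \sum_(m < (2 * n).+1) (tent n m)%:R * cexp (m%:R * v) =
  cexp v * dirichlet n v ^+ 2.
Proof.
under eq_bigr => m _.
  rewrite /tent natr_sum mulr_suml.
  under eq_bigr do rewrite natr_sum mulr_suml.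
  over.
rewrite exchange_big /= expr2 mulr_suml mulr_sumr; apply: eq_bigr => r _.
rewrite exchange_big /= !mulr_sumr; apply: eq_bigr => s _.
have h : ((r + s).+1 < (2 * n).+1)%N by have := ltn_ord r; have := ltn_ord s; lia.
rewrite (bigD1 (Ordinal h)) //= eqxx mul1r big1 ?addr0.
  by rewrite -!cexpD; congr cexp; rewrite -natr1 natrD; ring.
by move=> m; rewrite -val_eqE /= => /negbTE ->; rewrite mul0r.
Qed.

(** The modulus of the kernel is |D_n|^2, so orthogonality (discrete Parseval) evaluates the sum
    exactly. The average over q is n, with no logarithm: this is the facet that costs nothing. *)
Lemma sum_tent_kernel n N : (n <= N)%N ->
  \sum_(q < N) normc (\sum_(m < (2 * n).+1) (tent n m)%:R *
     cexp (m%:R * (q%:R / N%:R : R))) = (N * n)%:R.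
Proof.
move=> nN; apply: (@complexI R); rewrite rmorph_sum rmorph_nat.
transitivity (\sum_(q < N) \sum_(r < n) \sum_(s < n)
    cexp ((r%:R - s%:R) * (q%:R / N%:R : R))).
  apply: eq_bigr => q _; rewrite tent_kernelE; set v : R := _ / _.
  rewrite ComplexField.Normc.normcM normc_cexp mul1r expr2 ComplexField.Normc.normcM.
  transitivity (dirichlet n v * conjc (dirichlet n v)).
    rewrite rmorphM /= -expr2 -sqr_normc; congr (_ ^+ 2).
  rewrite {2}/dirichlet rmorph_sum mulr_suml; apply: eq_bigr => r _.
  rewrite mulr_sumr; apply: eq_bigr => s _.
  by rewrite [X in _ * X]conjc_cexp -cexpD -mulrBl.
rewrite exchange_big /=.
transitivity (\sum_(r < n) (N%:R : R[i])); last first.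
  by rewrite sumr_const card_ord natrM mulr_natr.
apply: eq_bigr => r _; rewrite exchange_big /=.
transitivity (\sum_(s < n) ((N * ((r : nat) == s))%:R : R[i])).
  apply: eq_bigr => s _; apply: sum_cexp_orthogonal;
  by have := ltn_ord s; have := ltn_ord r; lia.
rewrite (bigD1 r) //= eqxx muln1 big1 ?addr0// => s.
by rewrite -val_eqE /= eq_sym => /negbTE ->; rewrite muln0.
Qed.

End Fejer.

(** * Prefix sums of four coordinates *)

Section FourCoordinates.

Lemma forall_ord4 (P : 'I_4 -> Prop) : P i1 -> P i2 -> P i3 -> P i4 -> forall i, P i.
Proof.
move=> h1 h2 h3 h4 [[|[|[|[|m]]]] lt] //=.
- by rewrite (_ : Ordinal lt = i1)//; apply: val_inj.
- by rewrite (_ : Ordinal lt = i2)//; apply: val_inj.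
- by rewrite (_ : Ordinal lt = i3)//; apply: val_inj.
- by rewrite (_ : Ordinal lt = i4)//; apply: val_inj.
Qed.

Lemma sum_ord4 (V : nmodType) (x : 'I_4 -> V) :
  \sum_i x i = x i1 + x i2 + x i3 + x i4.
Proof.
rewrite !big_ord_recr big_ord0 /= add0r.
by congr (x _ + x _ + x _ + x _); apply: val_inj.
Qed.

Definition prefix_sum (V : nmodType) (x : 'I_4 -> V) (i : 'I_4) : V :=
  \sum_(j < 4 | (j <= i)%N) x j.

Lemma prefix_sumE (V : nmodType) (x : 'I_4 -> V) :
  [/\ prefix_sum x i1 = x i1, prefix_sum x i2 = x i1 + x i2,
      prefix_sum x i3 = x i1 + x i2 + x i3 &
      prefix_sum x i4 = x i1 + x i2 + x i3 + x i4].
Proof. by rewrite /prefix_sum; split; rewrite big_mkcond sum_ord4 /= ?addr0. Qed.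

(** Consecutive differences of prefix sums recover the last three entries, and the vanishing total
    recovers the first. *)
Lemma prefix_sum_diff_inj (x y : 'I_4 -> int) l :
  \sum_i x i = 0 -> \sum_i y i = 0 ->
  (forall i, prefix_sum x i - prefix_sum x l = prefix_sum y i - prefix_sum y l) ->
  forall i, x i = y i.
Proof.
rewrite !sum_ord4 => sx sy h.
move: (h i1) (h i2) (h i3) (h i4).
have [-> -> -> ->] := prefix_sumE x; have [-> -> -> ->] := prefix_sumE y.
by move=> ? ? ? ?; apply: forall_ord4; lia.
Qed.

Lemma prefix_sum_diff_le (x : 'I_4 -> int) (B : nat) i l :
  (forall j, `|x j| <= B%:Z) ->
  `|prefix_sum x i - prefix_sum x l| <= (4 * B)%:Z.
Proof.
move=> h; have [e1 e2 e3 e4] := prefix_sumE x.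
move: (h i1) (h i2) (h i3) (h i4) => {h}.
move: l; apply: forall_ord4; move: i; apply: forall_ord4;
  rewrite ?e1 ?e2 ?e3 ?e4; lia.
Qed.

Lemma prefix_sumB (V : zmodType) (x y : 'I_4 -> V) i :
  prefix_sum (fun j => x j - y j) i = prefix_sum x i - prefix_sum y i.
Proof. exact: sumrB. Qed.

End FourCoordinates.

(** * Exponential sums over the lattice simplex *)

Section SimplexKernel.
Variable R : realType.
Implicit Types (n : nat) (g : {ffun 'I_4 -> bool} -> R) (Q : 'I_4 -> R).

(** Although the constraint forces d_i <= n, the coordinates range up to 2n so that, once the
    constraint is removed, the whole support of [tent] is summed. *)
Definition simplex_sum n g Q : R[i] :=
  \sum_(d : {ffun 'I_4 -> 'I_(2 * n).+1} | (\sum_i (d i : nat))%N == n)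
    (g [ffun i => (d i : nat) == 0%N])%:C%C * cexp (\sum_i (d i)%:R * Q i).

Definition cell_weight n (l : 'I_4) (z : {ffun 'I_4 -> bool}) (i : 'I_4) (m : nat) : R[i] :=
  if i == l then (tent n m)%:R else ((m == 0%N) == z i)%:R.

(** Only the zero pattern of d itself survives in the sum over z, and [tent] is the identity up to
    n. If d_l = 0 both sides vanish, so patterns with [z l] may be left out. *)
Lemma cell_weight_expand n g l (d : {ffun 'I_4 -> 'I_(2 * n).+1}) :
  (d l <= n)%N ->
  (d l)%:R * (g [ffun i => (d i : nat) == 0%N])%:C%C =
  \sum_(z : {ffun 'I_4 -> bool} | ~~ z l) (g z)%:C%C * \prod_i cell_weight n l z i (d i).
Proof.
move=> dn; have [d0|d0] := eqVneq (d l : nat) 0%N.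
  rewrite d0 mul0r big1// => z _; rewrite (bigD1 l)//= /cell_weight eqxx.
  by rewrite d0 tentE// mul0r mulr0.
set zd := [ffun i => _]; have zdl : ~~ zd l by rewrite ffunE.
rewrite (bigD1 zd)//= [X in _ + X]big1 ?addr0; last first.
  move=> z /andP[zl nz]; apply/eqP; rewrite mulf_eq0; apply/orP; right.
  have [i neq] : exists i, z i != zd i.
    apply/existsP; apply: contraR nz; rewrite negb_exists => /forallP h.
    by apply/eqP/ffunP => i; apply/eqP; have := h i; rewrite negbK.
  have il : i != l by apply: contraNneq neq => ->; rewrite (negbTE zl) (negbTE zdl).
  rewrite (bigD1 i)//= /cell_weight (negbTE il); move: neq; rewrite ffunE eq_sym.
  by move=> /negbTE ->; rewrite mul0r.
rewrite mulrC; congr (_ * _); rewrite (bigD1 l)//= {1}/cell_weight eqxx tentE//.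
rewrite big1 ?mulr1// => i il.
by rewrite /cell_weight (negbTE il) ffunE eqxx.
Qed.

(* Barycentric splitting [n = \sum_l d l] of the simplex: near vertex [l] only
   the three other facets matter, and the weight [d l] is absorbed by [tent]. *)
Lemma normc_simplex_sum_le n g Q (G : R) : (0 < n)%N -> (forall z, `|g z| <= G) ->
  normc (simplex_sum n g Q) <=
  G * \sum_(l < 4) \sum_(z : {ffun 'I_4 -> bool}) (8 * n)%:R^-1 *
    \sum_(q < 8 * n) (n%:R^-1 *
      normc (\sum_(m < (2 * n).+1) (tent n m)%:R * cexp (m%:R * (q%:R / (8 * n)%:R : R)))
      * \prod_(i | i != l) normc (facet_kernel n (z i) (Q i - Q l + q%:R / (8 * n)%:R))).
Proof.
move=> n0 gG; have nR : (0 : R) < n%:R by rewrite ltr0n.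
have G0 : 0 <= G by apply: le_trans (gG [ffun=> false]).
rewrite -(ler_pM2l nR) -[X in X * normc _](normc_nat R) -ComplexField.Normc.normcM.
have dle (d : {ffun 'I_4 -> 'I_(2 * n).+1}) l :
    (\sum_i (d i : nat))%N == n -> (d l <= n)%N.
  by move=> /eqP dn; rewrite -[X in (_ <= X)%N]dn (bigD1 l)//= leq_addr.
(* On the simplex sum_i d_i Q_i = n Q_l + sum_i d_i (Q_i - Q_l). Pulling out the unimodular e(n Q_l)
   leaves the tent coordinate l without a phase. *)
have -> : n%:R * simplex_sum n g Q = \sum_(l < 4) cexp (n%:R * Q l) *
    \sum_(z : {ffun 'I_4 -> bool} | ~~ z l) (g z)%:C%C *
    \sum_(d : {ffun 'I_4 -> 'I_(2 * n).+1} | (\sum_i (d i : nat))%N == n)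
      \prod_i (cell_weight n l z i (d i) * cexp ((d i)%:R * (Q i - Q l))).
  under [RHS]eq_bigr => l _.
    under eq_bigr do rewrite mulr_sumr.
    rewrite exchange_big mulr_sumr /=; over.
  rewrite exchange_big mulr_sumr /=; apply: eq_bigr => d dn.
  have nE (V : pzSemiRingType) : n%:R = \sum_i (d i)%:R :> V.
    by rewrite -natr_sum (eqP dn).
  rewrite mulrA [in LHS]nE !mulr_suml; apply: eq_bigr => l _.
  rewrite (cell_weight_expand _ (dle _ _ dn)) mulr_suml mulr_sumr.
  apply: eq_bigr => z _; rewrite big_split /= -cexp_sum mulrCA -!mulrA.
  congr (_ * _); rewrite mulrCA; congr (_ * _); rewrite -cexpD; congr cexp.
  rewrite [in RHS]nE mulr_suml -big_split /=.
  by apply: eq_bigr => i _; ring.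
apply: le_trans (normc_sum _ _) _; rewrite mulrCA !mulr_sumr; apply: ler_sum => l _.
rewrite ComplexField.Normc.normcM normc_cexp mul1r.
(* The patterns with [z l] are put back here as nonnegative terms, so the bound runs over all z. *)
apply: le_trans (normc_sum _ _) _; rewrite big_mkcond !mulr_sumr.
apply: ler_sum => z _; case: ifP => _; last first.
  rewrite mulr_ge0// mulr_ge0 ?ler0n// mulr_ge0 ?invr_ge0 ?ler0n// sumr_ge0// => q _.
  by rewrite !mulr_ge0 ?invr_ge0 ?ler0n ?normc_ge0// prodr_ge0// => i _; exact: normc_ge0.
rewrite ComplexField.Normc.normcM normc_real; apply: ler_pM; rewrite ?normr_ge0 ?normc_ge0//.
apply: le_trans (@normc_sum_ffun_prod_le R _ _ (8 * n) n
  (fun i m => cell_weight n l z i m * cexp (m%:R * (Q i - Q l))) _ _) _.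
- lia.
(* Four coordinates of size at most 2n add up to at most 8n < n + 8n, so the modulus 8n suffices. *)
- move=> d; rewrite (@leq_ltn_trans (\sum_(i < 4) 2 * n))//.
    by apply: leq_sum => i _; rewrite -ltnS.
  by rewrite sum_nat_const card_ord; lia.
rewrite mulrCA ler_pM2l ?invr_gt0 ?ltr0n ?muln_gt0// mulr_sumr.
apply: ler_sum => q _; rewrite (bigD1 l)//= mulrA mulrA divff ?lt0r_neq0// mul1r.
apply: ler_pM; first exact: normc_ge0.
- by apply: prodr_ge0 => i _; exact: normc_ge0.
- rewrite le_eqVlt; apply/orP; left; apply/eqP; congr normc; apply: eq_bigr => m _.
  by rewrite /cell_weight eqxx subrr mulr0 cexp0 mulr1.
apply: ler_prod => i il; rewrite normc_ge0/= le_eqVlt; apply/orP; left; apply/eqP.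
congr normc; apply: eq_bigr => m _.
by rewrite /cell_weight (negbTE il) -mulrA -cexpD -mulrDr.
Qed.

End SimplexKernel.

(** * Summing products of three kernels over the nodes *)

Section NodeSum.
Variable R : realType.
Implicit Types (n : nat).

Lemma sum_injective_le (I J : finType) (P : pred I) (h : I -> J) (F : J -> R) :
  {in P &, injective h} -> (forall j, 0 <= F j) ->
  \sum_(i | P i) F (h i) <= \sum_j F j.
Proof.
move=> hinj F0.
rewrite (eq_bigl (fun i => i \in [set i | P i]%SET)); last by move=> i; rewrite inE.
rewrite -(@big_imset _ _ _ _ _ h _ (fun j => F j)).
  by rewrite [leRHS](bigID (mem (h @: [set i | P i]%SET))) /= lerDl sumr_ge0.
by move=> i j; rewrite !inE; apply: hinj.
Qed.

Lemma boxpt_le n (a : {ffun 'I_4 -> 'I_(8 * n + 1)}) i : `|boxpt a i| <= (4 * n)%:Z.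
Proof. by rewrite /boxpt; have := ltn_ord (a i); lia. Qed.

Lemma inH_sum (k : 'I_4 -> int) : inH k -> \sum_i k i = 0.
Proof. by case/andP => /eqP. Qed.

(** The integer differences of prefix sums determine the node, so the sum over nodes is dominated by
    the sum over a full cube of such differences, which factors into three one-dimensional grid
    sums. *)
Lemma sum_nodes_facet_kernel_le n (l : 'I_4) (z : {ffun 'I_4 -> bool})
    (s : {perm 'I_4}) (b : 'I_4 -> R) : (2 <= n)%N ->
  \sum_(a : {ffun 'I_4 -> 'I_(8 * n + 1)} | inLambda n (boxpt a))
    \prod_(i | i != l) normc (facet_kernel n (z i)
      (b i - (prefix_sum (boxpt a \o s) i - prefix_sum (boxpt a \o s) l)%:~R
        / (4 * n)%:R))
  <= (960 * (n%:R * ln n%:R)) ^+ 3.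
Proof.
move=> n2.
pose D (a : {ffun 'I_4 -> 'I_(8 * n + 1)}) i : int :=
  prefix_sum (boxpt a \o s) i - prefix_sum (boxpt a \o s) l.
have DB a i : `|D a i| <= (4 * (4 * n))%:Z.
  by apply: prefix_sum_diff_le => j; apply: boxpt_le.
(* The differences lie in [-16n, 16n]; reflecting and shifting by 16n maps them into 0..32n and
   turns the minus sign of the kernel argument into a plus. *)
pose h (a : {ffun 'I_4 -> 'I_(8 * n + 1)}) : {ffun 'I_4 -> 'I_(32 * n).+1} :=
  [ffun i => inord (absz ((16 * n)%:Z - D a i))].
have hE a i : (h a i)%:Z = (16 * n)%:Z - D a i.
  move: (DB a i); rewrite ffunE; move: (D a i) => w hw; rewrite inordK; lia.
(* The l-th difference is always 0, that is m = 16n; an indicator of total mass 1 keeps this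
   coordinate from contributing to the product. *)
pose F (i : 'I_4) (m : nat) : R :=
  if i == l then (m == (16 * n)%N)%:R
  else normc (facet_kernel n (z i) (b i - (16 * n)%:R / (4 * n)%:R + m%:R / (4 * n)%:R)).
have F0 i m : 0 <= F i m by rewrite /F; case: ifP => _; rewrite ?ler0n ?normc_ge0.
apply: (@le_trans _ _ (\sum_(a | inLambda n (boxpt a)) \prod_i F i (h a i))).
  apply: ler_sum => a _; rewrite [leRHS](bigD1 l)//=.
  have -> : F l (h a l) = 1.
    rewrite /F eqxx; have := hE a l; rewrite /D subrr => e.
    by rewrite (_ : nat_of_ord (h a l) = 16 * n)%N ?eqxx//; lia.
  rewrite mul1r le_eqVlt; apply/orP; left; apply/eqP; apply: eq_bigr => i il.
  rewrite /F (negbTE il) -/(D a i); congr (normc (facet_kernel _ _ _)).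
  have -> : (h a i)%:R = (16 * n)%:R - (D a i)%:~R :> R.
    by rewrite pmulrn hE intrB pmulrn.
  by rewrite mulrBl; ring.
apply: (@le_trans _ _ (\sum_(m : {ffun 'I_4 -> 'I_(32 * n).+1}) \prod_i F i (m i))).
  apply: (@sum_injective_le _ _ _ h (fun m => \prod_i F i (m i))); last first.
    by move=> m; apply: prodr_ge0.
  move=> a a' /andP[/inH_sum s0 _] /andP[/inH_sum s0' _] e.
  have eD i : D a i = D a' i by have := hE a i; have := hE a' i; rewrite e; lia.
  have sum_s (c : {ffun 'I_4 -> 'I_(8 * n + 1)}) : \sum_i boxpt c i = 0 ->
      \sum_i (boxpt c \o s) i = 0.
    by move=> c0; rewrite -[RHS]c0 [RHS](reindex_inj (@perm_inj _ s)).
  have es := prefix_sum_diff_inj (sum_s _ s0) (sum_s _ s0') eD.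
  apply/ffunP => i; apply: val_inj => /=.
  by have := es (s^-1%g i); rewrite /= permKV /boxpt; lia.
rewrite -(bigA_distr_bigA (fun i (m : 'I_(32 * n).+1) => F i m)) /= (bigD1 l)//=.
have -> : \sum_(m < (32 * n).+1) F l m = 1.
  have h16 : (16 * n < (32 * n).+1)%N by lia.
  rewrite (bigD1 (Ordinal h16))//= /F !eqxx big1 ?addr0// => m.
  by rewrite -val_eqE /= => /negbTE ->.
rewrite mul1r; apply: (@le_trans _ _ (\prod_(i | i != l) (960 * (n%:R * ln n%:R)))).
  apply: ler_prod => i il; apply/andP; split; first by apply: sumr_ge0.
  under eq_bigr do rewrite /F (negbTE il).
  exact: sum_facet_kernel_le.
by rewrite prodr_const cardC1 card_ord.
Qed.

End NodeSum.

(** * Gap coordinates: the index set as a lattice simplex *)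

Section SimplexCoordinates.
Implicit Types (n : nat) (k : 'I_4 -> int).

Definition gap n k (i : 'I_4) : int :=
  nth 0 [:: k i1 - k i2; k i2 - k i3; k i3 - k i4; k i4 + (4 * n)%:Z - k i1] i.

Definition zero_gaps n k : {ffun 'I_4 -> bool} := [ffun i => gap n k i == 0].

(** The smallest coordinate m is forced by the vanishing total: 4m + 4(d_1 + 2 d_2 + 3 d_3) = 0. *)
Definition point_of_gaps (d : 'I_4 -> nat) (i : 'I_4) : int :=
  let m : int := - (d i1 + 2 * d i2 + 3 * d i3)%N%:Z in
  nth 0 [:: m + (4 * (d i1 + d i2 + d i3))%N%:Z; m + (4 * (d i2 + d i3))%N%:Z;
            m + (4 * d i3)%N%:Z; m] i.

Lemma gap_point_of_gaps n (d : 'I_4 -> nat) : (\sum_i d i = n)%N ->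
  forall i, gap n (point_of_gaps d) i = (4 * d i)%N%:Z.
Proof. by rewrite sum_ord4 => sd; apply: forall_ord4; rewrite /gap /point_of_gaps /=; lia. Qed.

Lemma inLambdaP n k : reflect
  [/\ \sum_i k i = 0, forall i j, (k i %% 4 = k j %% 4)%Z & forall i, 0 <= gap n k i]
  (inLambda n k).
Proof.
apply: (iffP and5P) => [[/andP[/eqP sk /forallP kk] h1 h2 h3 h4]|[sk kk h]].
  split=> //; first by move=> i j; have /forallP/(_ j)/eqP := kk i.
  by apply: forall_ord4; rewrite /gap /=; lia.
have := (h i1, h i2, h i3, h i4); rewrite /gap /= => -[[[h1 h2] h3] h4].
split; [|lia|lia|lia|lia].
apply/andP; split; first exact/eqP.
by apply/forallP => i; apply/forallP => j; apply/eqP.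
Qed.

Lemma inLambda_point_of_gaps n (d : 'I_4 -> nat) : (\sum_i d i = n)%N ->
  inLambda n (point_of_gaps d).
Proof.
move=> sd; apply/inLambdaP; split.
- by rewrite sum_ord4 /point_of_gaps /=; lia.
- by apply: forall_ord4; apply: forall_ord4; rewrite /point_of_gaps /=; lia.
- by move=> i; rewrite (gap_point_of_gaps sd).
Qed.

(** The coordinates agree modulo 4, so every gap is divisible by 4; the four gaps add up to 4n. *)
Lemma gap_inLambda n k : inLambda n k ->
  exists d : 'I_4 -> nat, [/\ forall i, gap n k i = (4 * d i)%N%:Z,
    (\sum_i d i = n)%N & forall i, k i = point_of_gaps d i].
Proof.
move=> /inLambdaP[sk kk h]; exists (fun i => absz (gap n k i %/ 4)%Z).
have e i : gap n k i = (4 * `|(gap n k i %/ 4)%Z|)%N%:Z.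
  move: (h i) (kk i1 i2) (kk i2 i3) (kk i3 i4) (kk i4 i1).
  by move: i; apply: forall_ord4; rewrite /gap /=; lia.
split=> //.
  rewrite sum_ord4; move: (e i1) (e i2) (e i3) (e i4); rewrite /gap /=; lia.
move: (e i1) (e i2) (e i3) (e i4); rewrite sum_ord4 in sk.
by rewrite {1 3 5 7}/gap /= => ? ? ? ?; apply: forall_ord4; rewrite /point_of_gaps /=; lia.
Qed.

Definition box_of_gaps n (d : {ffun 'I_4 -> 'I_(2 * n).+1}) :
    {ffun 'I_4 -> 'I_(8 * n + 1)} :=
  [ffun i => cast_ord (esym (addn1 _))
    (inord (absz (point_of_gaps (fun j => d j) i + (4 * n)%:Z)))].

Definition gaps_of_box n (a : {ffun 'I_4 -> 'I_(8 * n + 1)}) :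
    {ffun 'I_4 -> 'I_(2 * n).+1} :=
  [ffun i => inord (absz (gap n (boxpt a) i %/ 4)%Z)].

Lemma boxpt_of_gaps n (d : {ffun 'I_4 -> 'I_(2 * n).+1}) :
  (\sum_i (d i : nat) = n)%N -> boxpt (box_of_gaps d) = point_of_gaps (fun i => d i).
Proof.
move=> sd; apply/funext => i; rewrite /boxpt ffunE /=.
have : `|point_of_gaps (fun i => d i) i| <= (4 * n)%:Z.
  rewrite sum_ord4 in sd.
  by move: i; apply: forall_ord4; rewrite /point_of_gaps /=; lia.
by move: (point_of_gaps _ _) => w hw; rewrite inordK; lia.
Qed.

Lemma gaps_of_boxE n (a : {ffun 'I_4 -> 'I_(8 * n + 1)}) : inLambda n (boxpt a) ->
  [/\ forall i, gap n (boxpt a) i = (4 * gaps_of_box a i)%N%:Z,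
      (\sum_i (gaps_of_box a i : nat) = n)%N & box_of_gaps (gaps_of_box a) = a].
Proof.
move=> /gap_inLambda[d [gd sd kd]].
have e i : (gaps_of_box a i : nat) = d i.
  have : (d i <= n)%N by rewrite -sd (bigD1 i)//= leq_addr.
  by rewrite ffunE gd => hd; rewrite inordK; lia.
have s : (\sum_i (gaps_of_box a i : nat) = n)%N.
  by rewrite -[RHS]sd; apply: eq_bigr => i _; rewrite e.
split=> // [i|]; first by rewrite e.
apply/ffunP => i; apply: val_inj => /=.
have := congr1 (fun k => k i) (boxpt_of_gaps s).
have -> : point_of_gaps (fun i => gaps_of_box a i) i = boxpt a i.
  by rewrite kd; congr (point_of_gaps _ i); apply/funext => j; rewrite e.
by rewrite /boxpt; lia.
Qed.

(** This is the side condition produced by [reindex_onto]. Vectors d off the simplex may meet the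
    default of [inord], but then the round trip does not return d. *)
Lemma gaps_of_boxK n (d : {ffun 'I_4 -> 'I_(2 * n).+1}) :
  (inLambda n (boxpt (box_of_gaps d)) && (gaps_of_box (box_of_gaps d) == d)) =
  ((\sum_i (d i : nat))%N == n).
Proof.
apply/andP/eqP => [[/gaps_of_boxE[_ s _] /eqP e]|sd]; first by rewrite -[RHS]s e.
have L : inLambda n (boxpt (box_of_gaps d)).
  by rewrite boxpt_of_gaps//; exact: inLambda_point_of_gaps.
split=> //; apply/eqP/ffunP => i; apply: val_inj => /=.
have [/(_ i)] := gaps_of_boxE L.
by rewrite {1}(boxpt_of_gaps sd) (gap_point_of_gaps sd) => e _ _; lia.
Qed.

Variable R : realType.

Lemma phi_cexp k (w : 'rV[R]_4) : phi k w = cexp (dotk k w / 4).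
Proof.
rewrite /phi /cexp; have -> : pi / 2 * dotk k w = 2 * pi * (dotk k w / 4) by field.
by [].
Qed.

(** Summation by parts in k.w / 4; the last prefix sum is the total of w, hence zero. *)
Lemma phi_point_of_gaps (d : 'I_4 -> nat) (w : 'rV[R]_4) :
  \sum_i w ord0 i = 0 ->
  phi (point_of_gaps d) w = cexp (\sum_i (d i)%:R * prefix_sum (w ord0) i).
Proof.
rewrite !sum_ord4 => sw; rewrite phi_cexp; congr cexp.
have [-> -> -> ->] := prefix_sumE (w ord0); rewrite sw mulr0 addr0.
have w4 : w ord0 i4 = - (w ord0 i1 + w ord0 i2 + w ord0 i3) by lra.
rewrite /dotk sum_ord4 w4 /point_of_gaps /= !(intrD, intrN) -!pmulrn !(natrD, natrM).
by field.
Qed.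

Lemma sumLambda_phi n (g : {ffun 'I_4 -> bool} -> R) (w : 'rV[R]_4) :
  \sum_i w ord0 i = 0 ->
  sumLambda n (fun k => (g (zero_gaps n k))%:C%C * phi k w) =
  simplex_sum n g (prefix_sum (w ord0)).
Proof.
move=> sw; rewrite /sumLambda (reindex_onto (@box_of_gaps n) (@gaps_of_box n)) /=; last first.
  by move=> a /gaps_of_boxE[].
apply: eq_big => [d|d]; first exact: gaps_of_boxK.
rewrite gaps_of_boxK => /eqP sd; rewrite boxpt_of_gaps// phi_point_of_gaps//.
congr ((g _)%:C%C * _); apply/ffunP => i.
by rewrite !ffunE (gap_point_of_gaps sd); apply/eqP/eqP; lia.
Qed.

End SimplexCoordinates.

(** * Expansion over permutations and the node sum of simplex kernels *)

Section NodeKernelSum.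
Variable R : realType.
Implicit Types (n : nat) (t x y : 'rV[R]_4).

Lemma phi_conjc_phi k x y : phi k x * conjc (phi k y) = phi k (x - y).
Proof.
rewrite !phi_cexp conjc_cexp -cexpD; congr cexp; rewrite -mulNr -mulrDl.
congr (_ / _); rewrite /dotk -sumrB; apply: eq_bigr => i _.
by rewrite !mxE mulrBr.
Qed.

Lemma sum_tperm t (s : {perm 'I_4}) : \sum_i Defs.tperm t s ord0 i = \sum_i t ord0 i.
Proof.
rewrite [RHS](reindex_inj (@perm_inj _ s)).
by apply: eq_bigr => i _; rewrite mxE.
Qed.

Lemma sum_node n k : \sum_i k i = 0 -> \sum_i node R n k ord0 i = 0.
Proof.
move=> k0; under eq_bigr do rewrite mxE.
by rewrite -mulr_suml -mulrz_sumr k0 mul0r.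
Qed.

Lemma node_triangleH n k : (0 < n)%N -> inLambda n k -> triangleH (node R n k).
Proof.
move=> n0 /and5P[/andP[/eqP sk _] h1 h2 h3 h4].
have n0' : (0 : R) < (4 * n)%:R by rewrite ltr0n; lia.
have diff i j : k j <= k i -> k i <= k j + (4 * n)%:Z ->
    0 <= node R n k ord0 i - node R n k ord0 j <= 1.
  move=> hij hji; rewrite !mxE -mulrBl -intrB; apply/andP; split.
    by rewrite divr_ge0 ?ler0z ?ler0n//; lia.
  by rewrite ler_pdivrMr// mul1r pmulrn ler_int; lia.
split; first exact: sum_node.
by do ![split]; apply: diff; lia.
Qed.

(** Multiplying out the two permutation sums leaves characters at differences of permuted points.
    The unimodular [eps] covers both cases: signs for [TS], the constant 1 for [TC]. *)
Lemma normc_symmetrized_sum_le n (g : {ffun 'I_4 -> bool} -> R)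
    (eps : {perm 'I_4} -> R[i]) x y :
  \sum_i x ord0 i = 0 -> \sum_i y ord0 i = 0 -> (forall s, normc (eps s) = 1) ->
  normc (sumLambda n (fun k => (g (zero_gaps n k))%:C%C *
    (\sum_s eps s * phi k (Defs.tperm x s)) *
    conjc (\sum_s eps s * phi k (Defs.tperm y s)))) <=
  \sum_(s : {perm 'I_4}) \sum_(s' : {perm 'I_4})
    normc (simplex_sum n g (prefix_sum ((Defs.tperm x s - Defs.tperm y s') ord0))).
Proof.
move=> sx sy eps1.
have -> : sumLambda n (fun k => (g (zero_gaps n k))%:C%C *
    (\sum_s eps s * phi k (Defs.tperm x s)) *
    conjc (\sum_s eps s * phi k (Defs.tperm y s))) =
  \sum_(s : {perm 'I_4}) \sum_(s' : {perm 'I_4}) (eps s * conjc (eps s')) *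
    sumLambda n (fun k => (g (zero_gaps n k))%:C%C *
      phi k (Defs.tperm x s - Defs.tperm y s')).
  under [RHS]eq_bigr => s _.
    under eq_bigr do rewrite /sumLambda mulr_sumr.
    rewrite exchange_big /=; over.
  rewrite exchange_big /=; apply: eq_bigr => a _.
  rewrite -mulrA mulr_suml mulr_sumr; apply: eq_bigr => s _.
  have -> : conjc (\sum_s eps s * phi (boxpt a) (Defs.tperm y s)) =
      \sum_s conjc (eps s) * conjc (phi (boxpt a) (Defs.tperm y s)).
    by rewrite [LHS]rmorph_sum; apply: eq_bigr => s' _; exact: rmorphM.
  rewrite !mulr_sumr; apply: eq_bigr => s' _.
  by rewrite -phi_conjc_phi; ring.
apply: le_trans (normc_sum _ _) _; apply: ler_sum => s _.
apply: le_trans (normc_sum _ _) _; apply: ler_sum => s' _.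
rewrite 2!ComplexField.Normc.normcM normc_conjc !eps1 !mul1r sumLambda_phi//.
under eq_bigr do rewrite !mxE.
rewrite sumrB -[X in X - _](_ : \sum_i Defs.tperm x s ord0 i = _); last first.
  by apply: eq_bigr => i _; rewrite mxE.
rewrite -[X in _ - X](_ : \sum_i Defs.tperm y s' ord0 i = _); last first.
  by apply: eq_bigr => i _; rewrite mxE.
by rewrite !sum_tperm sx sy subrr.
Qed.

Lemma sum_nodes_simplex_sum_le n (g : {ffun 'I_4 -> bool} -> R) (G : R) x
    (s' : {perm 'I_4}) : (2 <= n)%N -> (forall z, `|g z| <= G) ->
  \sum_(a : {ffun 'I_4 -> 'I_(8 * n + 1)} | inLambda n (boxpt a))
    normc (simplex_sum n g
      (prefix_sum ((x - Defs.tperm (node R n (boxpt a)) s') ord0)))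
  <= G * (64 * (960 * (n%:R * ln n%:R)) ^+ 3).
Proof.
move=> n2 gG; have n0 : (0 < n)%N by lia.
have G0 : 0 <= G by apply: le_trans (gG [ffun=> false]).
set B := (960 * _) ^+ 3.
apply: le_trans (ler_sum _ (fun a _ => normc_simplex_sum_le _ n0 gG)) _.
rewrite -mulr_sumr ler_wpM2l// exchange_big /=.
(* The factor 64 counts 4 vertices times 2^4 zero patterns. *)
apply: (@le_trans _ _ (\sum_(l < 4) \sum_(z : {ffun 'I_4 -> bool}) B)); last first.
  by rewrite !sumr_const card_ffun card_bool !card_ord -!mulrnA mulr_natl.
apply: ler_sum => l _; rewrite exchange_big /=; apply: ler_sum => z _.
rewrite -mulr_sumr ler_pdivrMl ?ltr0n ?muln_gt0//.
rewrite exchange_big /=.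
(* The Fejer sum 8n * n cancels the factors 1/(8n) and 1/n exactly. Substituting it on the right
   makes the inequality termwise in q, where the node sum is at most B whatever the shift q/(8n). *)
have V := @sum_tent_kernel R n (8 * n) (leq_pmull _ _).
rewrite -[X in _ <= X * _](mulfK (_ : n%:R != 0)) ?pnatr_eq0; last by lia.
rewrite -natrM -V; last by [].
rewrite mulrAC mulrC mulr_suml mulr_sumr.
apply: ler_sum => q _; rewrite -mulr_sumr -mulrA.
rewrite ler_wpM2l ?invr_ge0 ?ler0n//.
rewrite ler_wpM2l ?normc_ge0//.
pose b i : R := prefix_sum (x ord0) i - prefix_sum (x ord0) l + q%:R / (8 * n)%:R.
apply: le_trans (sum_nodes_facet_kernel_le l z s' b n2).
apply: ler_sum => a _; rewrite le_eqVlt; apply/orP; left; apply/eqP.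
apply: eq_bigr => i il; congr (normc (facet_kernel _ _ _)).
have e j : prefix_sum ((x - Defs.tperm (node R n (boxpt a)) s') ord0) j =
   prefix_sum (x ord0) j - (prefix_sum (boxpt a \o s') j)%:~R / (4 * n)%:R.
  transitivity (prefix_sum (fun i => x ord0 i -
      (boxpt a (s' i))%:~R / (4 * n)%:R) j).
    by apply: eq_bigr => h _; rewrite !mxE.
  rewrite prefix_sumB; congr (_ - _).
  by rewrite /prefix_sum mulrz_sumr mulr_suml.
rewrite !e /b intrB mulrBl; ring.
Qed.

End NodeKernelSum.

(** * Bounds for the two interpolation operators *)

Section Norms.
Variable R : realType.
Implicit Types (n : nat).

Definition lambda_weight (z : {ffun 'I_4 -> bool}) : R :=
  let m := (z i1 + z i2 + z i3 + z i4)%N in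
  if m == 0%N then 24
  else if m == 1%N then 12
  else if m == 2%N then (if (z i1 && z i3) || (z i2 && z i4) then 6 else 4)
  else 1.

Lemma lambda_weight_bound z : `|lambda_weight z| <= 24.
Proof. by rewrite /lambda_weight; do !case: ifP => _; rewrite ger0_norm; lra. Qed.

Lemma lambdan_zero_gaps n k : lambdan R n k = lambda_weight (zero_gaps n k).
Proof.
rewrite /lambdan /lambda_weight !ffunE /gap /= !subr_eq0.
by rewrite [k i1 == k i4 + _]eq_sym.
Qed.

Definition interior_weight (z : {ffun 'I_4 -> bool}) : R := [forall i, ~~ z i]%:R.

(** The bound is crude on purpose: it matches [lambda_weight_bound], so one kernel estimate serves
    both operators. *)
Lemma interior_weight_bound z : `|interior_weight z| <= 24.
Proof. by rewrite /interior_weight normr_nat ler_nat; case: forallP. Qed.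

Lemma inLambdao_zero_gaps n k :
  inLambdao n k = inLambda n k && [forall i, ~~ zero_gaps n k i].
Proof.
apply/and5P/andP => [[hH h1 h2 h3 h4]|[/and5P[hH h1 h2 h3 h4] /forallP h]].
  split; first by apply/and5P; split=> //; lia.
  by apply/forallP; apply: forall_ord4; rewrite ffunE /gap /=; lia.
have := (h i1, h i2, h i3, h i4); rewrite !ffunE /gap /= => -[[[? ?] ?] ?].
by split=> //; lia.
Qed.

(** Interior points are those without a vanishing gap, so restricting to them is one more weight
    depending only on the zero pattern. *)
Lemma sumLambdao_weight n (F : ('I_4 -> int) -> R[i]) :
  sumLambdao n F =
  sumLambda n (fun k => (interior_weight (zero_gaps n k))%:C%C * F k).
Proof.
rewrite /sumLambdao /sumLambda; under eq_bigl do rewrite inLambdao_zero_gaps.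
rewrite big_mkcondr /=; apply: eq_bigr => a _.
by rewrite /interior_weight; case: ifP => _; rewrite ?mul1r ?mul0r.
Qed.

Lemma sum_nodes_kernel_le n (g : {ffun 'I_4 -> bool} -> R)
    (eps : {perm 'I_4} -> R[i]) (t : 'rV[R]_4) :
  (2 <= n)%N -> (forall z, `|g z| <= 24) -> \sum_i t ord0 i = 0 ->
  (forall s, normc (eps s) = 1) ->
  \sum_(a : {ffun 'I_4 -> 'I_(8 * n + 1)} | inLambda n (boxpt a))
    normc (sumLambda n (fun k => (g (zero_gaps n k))%:C%C *
      (\sum_s eps s * phi k (Defs.tperm t s)) *
      conjc (\sum_s eps s * phi k (Defs.tperm (node R n (boxpt a)) s)))) <=
  (#|{perm 'I_4}| ^ 2)%:R * (24 * (64 * (960 * (n%:R * ln n%:R)) ^+ 3)).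
Proof.
move=> n2 g24 st eps1.
apply: (@le_trans _ _ (\sum_(a | inLambda n (boxpt a))
  \sum_(s : {perm 'I_4}) \sum_(s' : {perm 'I_4}) normc (simplex_sum n g
    (prefix_sum ((Defs.tperm t s - Defs.tperm (node R n (boxpt a)) s') ord0))))).
  apply: ler_sum => a La; apply: normc_symmetrized_sum_le => //.
  by apply: sum_node; case/andP: La => /inH_sum.
rewrite exchange_big /=.
under eq_bigr do rewrite exchange_big /=.
apply: (@le_trans _ _ (\sum_(s : {perm 'I_4}) \sum_(s' : {perm 'I_4})
    24 * (64 * (960 * (n%:R * ln n%:R)) ^+ 3))).
  by apply: ler_sum => s _; apply: ler_sum => s' _; apply: sum_nodes_simplex_sum_le.
by move: (24 * _) => X; rewrite !sumr_const -mulrnA mulr_natl mulnn.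
Qed.

(** All nodes lie in the triangle, so M bounds f there. The predicate [P] lets a sum over interior
    nodes be compared with the estimate over all nodes. *)
Lemma weighted_node_sum_le n (f : 'rV[R]_4 -> R[i]) (M c B : R)
    (v : ('I_4 -> int) -> R) (P : ('I_4 -> int) -> bool) (K : ('I_4 -> int) -> R[i]) :
  (0 < n)%N -> (forall k, P k -> inLambda n k) ->
  (forall s, triangleH s -> normc (f s) <= M) -> 0 <= M ->
  (forall k, `|v k| <= c) ->
  \sum_(a : {ffun 'I_4 -> 'I_(8 * n + 1)} | inLambda n (boxpt a)) normc (K (boxpt a)) <= B ->
  normc (\sum_(a : {ffun 'I_4 -> 'I_(8 * n + 1)} | P (boxpt a))
    f (node R n (boxpt a)) * (v (boxpt a))%:C%C * K (boxpt a)) <= M * c * B.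
Proof.
move=> n0 PL fM M0 vc KB; have c0 : 0 <= c by apply: le_trans (vc (fun=> 0)).
apply: le_trans (normc_sum _ _) _.
apply: (@le_trans _ _ (M * c * \sum_(a | inLambda n (@boxpt n a)) normc (K (boxpt a)))); last first.
  by apply: ler_wpM2l => //; exact: mulr_ge0.
rewrite mulr_sumr big_mkcond [leRHS]big_mkcond; apply: ler_sum => a _ /=.
case: ifPn => [/PL La|_]; last first.
  by case: ifP => // _; rewrite !mulr_ge0// normc_ge0.
rewrite La 2!ComplexField.Normc.normcM normc_real.
apply: ler_wpM2r; first exact: normc_ge0.
by apply: ler_pM; rewrite ?normc_ge0 ?normr_ge0// fM//; exact: node_triangleH.
Qed.

Definition lebesgue_const : R := (#|{perm 'I_4}| ^ 2)%:R * (24 * (64 * 960 ^+ 3)).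

Lemma lebesgue_constE n :
  (#|{perm 'I_4}| ^ 2)%:R * (24 * (64 * (960 * (n%:R * ln n%:R)) ^+ 3)) =
  n%:R ^+ 3 * (lebesgue_const * ln n%:R ^+ 3) :> R.
Proof.
rewrite /lebesgue_const !exprMn.
by move: (_ ^ 2)%:R (ln _) => p l; ring.
Qed.

Lemma TC_conjc_TC k (x y : 'rV[R]_4) :
  TC k x * conjc (TC k y) = (24^-1 ^+ 2 : R)%:C%C *
    ((\sum_(s : {perm 'I_4}) 1 * phi k (Defs.tperm x s)) *
     conjc (\sum_(s : {perm 'I_4}) 1 * phi k (Defs.tperm y s))).
Proof.
rewrite /TC; have -> z : (((24^-1 : R)%:C * z)^* = (24^-1 : R)%:C * z^*)%C.
  by rewrite rmorphM /= oppr0.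
under [in RHS]eq_bigr do rewrite mul1r.
under [X in _ = _ * (_ * conjc X)]eq_bigr do rewrite mul1r.
by rewrite rmorphXn /=; ring.
Qed.

Lemma TS_conjc_TS k (x y : 'rV[R]_4) :
  TS k x * conjc (TS k y) = (24^-1 ^+ 2 : R)%:C%C *
    ((\sum_(s : {perm 'I_4}) (-1) ^+ (odd_perm s) * phi k (Defs.tperm x s)) *
     conjc (\sum_(s : {perm 'I_4}) (-1) ^+ (odd_perm s) * phi k (Defs.tperm y s))).
Proof.
rewrite /TS; have -> z : ((- ((24^-1 : R)%:C * z))^* = - ((24^-1 : R)%:C * z^*))%C.
  by rewrite rmorphN rmorphM /= oppr0.
by rewrite rmorphXn /=; ring.
Qed.

Lemma normc_scale_sumLambda_le n (F G : ('I_4 -> int) -> R[i]) (c : R) :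
  `|c| <= 1 -> (forall k, F k = c%:C%C * G k) ->
  normc (sumLambda n F) <= normc (sumLambda n G).
Proof.
move=> c1 FG; rewrite /sumLambda; under eq_bigr do rewrite FG.
rewrite -mulr_sumr ComplexField.Normc.normcM normc_real.
by rewrite ler_piMl// normc_ge0.
Qed.

Lemma inv24_sqr_le1 : `|24^-1 ^+ 2| <= 1 :> R.
Proof. by rewrite ger0_norm; lra. Qed.

Lemma Ln_bound n (f : 'rV[R]_4 -> R[i]) (M : R) (t : 'rV[R]_4) :
  (2 <= n)%N -> (forall s, triangleH s -> normc (f s) <= M) -> 0 <= M ->
  \sum_i t ord0 i = 0 ->
  normc (Ln n f t) <= 144 * lebesgue_const * ln n%:R ^+ 3 * M.
Proof.
move=> n2 fM M0 t0; have n0 : (0 : R) < n%:R ^+ 3 by rewrite exprn_gt0// ltr0n; lia.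
have := sum_nodes_kernel_le (g := interior_weight)
  (eps := fun s => (-1) ^+ (odd_perm s)) n2 interior_weight_bound t0 _.
rewrite lebesgue_constE => /(_ _) H.
have {}H : \sum_(a : {ffun 'I_4 -> 'I_(8 * n + 1)} | inLambda n (boxpt a))
   normc (sumLambdao n (fun k => TS k t * conjc (TS k (node R n (boxpt a))))) <=
   n%:R ^+ 3 * (lebesgue_const * ln n%:R ^+ 3).
  apply: le_trans _ (H _); last first.
    by move=> s; case: odd_perm; rewrite ?expr1 ?normcN ComplexField.Normc.normc1.
  apply: ler_sum => a _; rewrite sumLambdao_weight.
  apply: (@normc_scale_sumLambda_le _ _ _ (24^-1 ^+ 2) inv24_sqr_le1) => k.
  by rewrite TS_conjc_TS mulrCA !mulrA.
have := weighted_node_sum_le (P := inLambdao n) (v := fun=> 144 / n%:R ^+ 3)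
  (c := 144 / n%:R ^+ 3)
  (K := fun j => sumLambdao n (fun k => TS k t * conjc (TS k (node R n j))))
  _ _ fM M0 _ H.
move=> /(_ _ _ _)/le_trans; apply.
- lia.
- by move=> k; rewrite inLambdao_zero_gaps => /andP[].
- by move=> _; rewrite ger0_norm// divr_ge0// ltW.
(* The n^3 from the three grid sums cancels against the quadrature weight 144 / n^3. *)
rewrite le_eqVlt; apply/orP; left; apply/eqP.
by move: (n%:R ^+ 3) n0 (ln _ ^+ 3) => N N0 l; field; exact: lt0r_neq0.
Qed.

Lemma Lnstar_bound n (f : 'rV[R]_4 -> R[i]) (M : R) (t : 'rV[R]_4) :
  (2 <= n)%N -> (forall s, triangleH s -> normc (f s) <= M) -> 0 <= M ->
  \sum_i t ord0 i = 0 ->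
  normc (Lnstar n f t) <= 6 * lebesgue_const * ln n%:R ^+ 3 * M.
Proof.
move=> n2 fM M0 t0; have n0 : (0 : R) < n%:R ^+ 3 by rewrite exprn_gt0// ltr0n; lia.
have := sum_nodes_kernel_le (g := lambda_weight)
  (eps := fun=> 1) n2 lambda_weight_bound t0 _.
rewrite lebesgue_constE => /(_ _) H.
have {}H : \sum_(a : {ffun 'I_4 -> 'I_(8 * n + 1)} | inLambda n (boxpt a))
   normc (sumLambda n (fun k => (lambdan R n k)%:C%C * TC k t *
     conjc (TC k (node R n (boxpt a))))) <=
   n%:R ^+ 3 * (lebesgue_const * ln n%:R ^+ 3).
  apply: le_trans _ (H _); last by move=> s; rewrite ComplexField.Normc.normc1.
  apply: ler_sum => a _.
  apply: (@normc_scale_sumLambda_le _ _ _ (24^-1 ^+ 2) inv24_sqr_le1) => k.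
  by rewrite -mulrA TC_conjc_TC mulrCA !mulrA lambdan_zero_gaps.
have := weighted_node_sum_le (P := inLambda n)
  (v := fun k => lambdan R n k / (4 * n%:R ^+ 3))
  (* The weights are at most 24, so the prefactor is 24/4 = 6 over n^3. *)
  (c := 24 / (4 * n%:R ^+ 3))
  (K := fun j => sumLambda n (fun k =>
    (lambdan R n k)%:C%C * TC k t * conjc (TC k (node R n j))))
  _ _ fM M0 _ H.
move=> /(_ _ _ _)/le_trans; apply.
- lia.
- by [].
- move=> k; rewrite lambdan_zero_gaps normrM.
  have h : 0 <= (4 * n%:R ^+ 3)^-1 :> R by rewrite invr_ge0 mulr_ge0// ltW.
  by rewrite [X in _ * X]ger0_norm//; apply: ler_wpM2r; rewrite ?lambda_weight_bound.
rewrite le_eqVlt; apply/orP; left; apply/eqP.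
by move: (n%:R ^+ 3) n0 (ln _ ^+ 3) => N N0 l; field; exact: lt0r_neq0.
Qed.

End Norms.

(* ||L_n|| <= c (log n)^3 and ||L_n^*|| <= c (log n)^3 as operators on
   C(triangle_H) (complex-valued, sup norm), unfolded: for every continuous f
   bounded by M on triangle_H, |L_n f(t)| <= c (log n)^3 M on triangle_H. *)
Theorem theorem4p8 (R : realType) :
  exists c : R, forall n : nat, (2 <= n)%N ->
    forall f : 'rV[R]_4 -> R[i],
      {within (@triangleH R), continuous (fun x => complex.Re (f x))} ->
      {within (@triangleH R), continuous (fun x => complex.Im (f x))} ->
      forall M : R, (forall s, @triangleH R s -> ComplexField.Normc.normc (f s) <= M) ->
      forall t, @triangleH R t ->
        ComplexField.Normc.normc (Ln n f t) <= c * (ln n%:R) ^+ 3 * M /\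
        ComplexField.Normc.normc (Lnstar n f t) <= c * (ln n%:R) ^+ 3 * M.
Proof.
(* The factor 144 is the larger of the two prefactors 144 and 6. *)
exists (144 * lebesgue_const R) => n n2 f _ _ M fM t tH.
have M0 : 0 <= M by exact: le_trans (normc_ge0 _) (fM _ tH).
have t0 : \sum_i t ord0 i = 0 by case: tH.
split; first exact: Ln_bound.
apply: le_trans (Lnstar_bound n2 fM M0 t0) _.
have l0 : 0 <= ln n%:R :> R by rewrite ln_ge0// ler1n; lia.
have L0 : 0 <= lebesgue_const R by rewrite /lebesgue_const !mulr_ge0 ?ler0n ?exprn_ge0.
apply: ler_wpM2r => //; apply: ler_wpM2r; first exact: exprn_ge0.
by apply: ler_wpM2r => //; rewrite ler_nat.
Qed.
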